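(* In n-gram watermarking with watermark strength $\delta$, let $T_i,T_j$ be two tokens, and let $R_{i,j}:=\log\left(\frac{P_W(T_i\mid\boldsymbol{x},T_i,T_j)}{P_W(T_j\mid\boldsymbol{x},T_i,T_j)}\right)$ be their relative probability ratio under random selection probing of the watermarked model in a context $\boldsymbol{x}$, where the unwatermarked probing probabilities are $P(T_i\mid\boldsymbol{x},T_i,T_j)=0.5+\epsilon$ and $P(T_j\mid\boldsymbol{x},T_i,T_j)=0.5-\epsilon$ with symmetrically distributed noise $\epsilon$. If $T_i$ and $T_j$ are not in the same red or green list, then $R_{i,j}$ is an unbiased estimator of $\delta$ (or $-\delta$): $\mathbb{E}_\epsilon[R_{i,j}]=\delta$ if $T_i$ is green and $T_j$ is red, and $\mathbb{E}_\epsilon[R_{i,j}]=-\delta$ if $T_i$ is red and $T_j$ is green.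
   Context: n-gram watermarking: let $V=\{t_1,\dots,t_N\}$ be the token set of a language model. A fixed secret key together with the prefix n-gram (the preceding tokens) determines a division of $V$ into a red list and a green list, and the logits of the green tokens are increased by $\delta$, called the watermark strength. Given an initial token probability $P$, the watermarked probability is $$P_W(t)=\begin{cases}\dfrac{P(t)}{\sum_{t'\in \mathrm{red}}P(t')+\sum_{t'\in\mathrm{green}}e^{\delta}P(t')}, & t\in\mathrm{red},\\[2ex] \dfrac{e^{\delta}P(t)}{\sum_{t'\in \mathrm{red}}P(t')+\sum_{t'\in\mathrm{green}}e^{\delta}P(t')}, & t\in\mathrm{green}.\end{cases}$$ Random selection probing: in a context $\boldsymbol{x}$ (a sequence of tokens of $V$), the language model is prompted to output randomly one of two tokens $T_i,T_j\in V$ with equal probability. $P(T_i\mid\boldsymbol{x},T_i,T_j)$ and $P(T_j\mid\boldsymbol{x},T_i,T_j)$ denote the probabilities with which the two tokens are generated without a watermark. Ideally both equal $0.5$; the noise model assumed is $P(T_i\mid\boldsymbol{x},T_i,T_j)=0.5+\epsilon$ and $P(T_j\mid\boldsymbol{x},T_i,T_j)=0.5-\epsilon$, where $\epsilon$ is symmetrically distributed, i.e. $p(\epsilon=\epsilon_0)=p(\epsilon=-\epsilon_0)$ for all $\epsilon_0\in\mathbb{R}$. The watermarked probabilities $P_W(T_i\mid\boldsymbol{x},T_i,T_j)$ and $P_W(T_j\mid\boldsymbol{x},T_i,T_j)$ are obtained by applying the watermarking formula above to this distribution on the two tokens. $\mathbb{E}_\epsilon$ denotes expectation over the noise $\ep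silon$.
   Formalization: It is additionally assumed that |ε| < 1/2 almost surely (so both probing probabilities are positive) and that R_{i,j} is integrable; for some symmetric noise, e.g. ε = tanh(C/2)/2 with C Cauchy, the expectation of R_{i,j} does not exist. *)

(* Defs.v *)
From mathcomp Require Import all_boot all_order all_algebra.
From mathcomp Require Import all_classical all_reals all_analysis.

Set Implicit Arguments.
Unset Strict Implicit.
Unset Printing Implicit Defensive.

Import Order.TTheory GRing.Theory Num.Theory.

Local Open Scope classical_set_scope.
Local Open Scope ring_scope.

(* [green_of k g] is the green part of the division of the vocabulary that key
   [k] and prefix n-gram [g] determine; the red part is its complement. *)
Record ngram_watermark (R : realType) (V : finType) := NgramWatermark {
  gram_length : nat;
  key_type : Type;
  secret_key : key_type;
  green_of : key_type -> seq V -> {set V};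
  strength : R
}.

Section NgramWatermark.
Context {R : realType} {V : finType}.
Implicit Types (W : ngram_watermark R V) (x : seq V) (p : V -> R).

(* The last n tokens of x, or all of x if it is shorter. *)
Definition prefix_ngram (n : nat) x : seq V := drop (size x - n) x.

Definition green_list W x : {set V} :=
  green_of (secret_key W) (prefix_ngram (gram_length W) x).

Definition red_list W x : {set V} := ~: green_list W x.

Definition watermarked W x p (t : V) : R :=
  (if t \in green_list W x then expR (strength W) * p t else p t) /
  (\sum_(t' in red_list W x) p t' +
   \sum_(t' in green_list W x) expR (strength W) * p t').

(* The unwatermarked answer distribution P(. | x, Ti, Tj) of random selection
   probing, with noise e. *)
Definition probing_prob (Ti Tj : V) (e : R) (t : V) : R :=
  if t == Ti then 2^-1 + e else if t == Tj then 2^-1 - e else 0.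

Definition relative_prob_ratio W x (Ti Tj : V) (e : R) : R :=
  ln (watermarked W x (probing_prob Ti Tj e) Ti /
      watermarked W x (probing_prob Ti Tj e) Tj).

End NgramWatermark.

(* eps and - eps have the same law.  This covers both readings of
   p(eps = e) = p(eps = - e), as probability masses or as densities. *)
Definition symmetrically_distributed d (Omega : measurableType d)
    (R : realType) (P : probability Omega R) (eps : Omega -> R) : Prop :=
  forall A : set R, measurable A ->
    P [set w | A (eps w)] = P [set w | A (- eps w)].

(* Main.v *)
(** For [|e| < 1/2] the normalising constants of the two watermarked
    probabilities cancel, and the log-ratio is the constant [delta] (or
    [- delta]) plus the log-odds [ln (1/2 + e) - ln (1/2 - e)] of the noise.
    The log-odds is an odd function, so under symmetric noise its expectation
    equals its own opposite; being finite, it vanishes. *)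
Require Import Defs.
From mathcomp Require Import all_boot all_order all_algebra.
From mathcomp Require Import all_classical all_reals all_analysis.
From mathcomp Require Import measurable_realfun lra.

Import Order.TTheory GRing.Theory Num.Theory.

Local Open Scope classical_set_scope.
Local Open Scope ring_scope.

Lemma integral_odd_symmetric (R : realType) (d : measure_display)
    (Omega : measurableType d) (P : probability Omega R) (X : {RV P >-> R})
    (f : R -> R) :
  symmetrically_distributed P X -> measurable_fun [set: R] f ->
  {morph f : e / - e} ->
  P.-integrable [set: Omega] (fun w => (f (X w))%:E) ->
  (\int[P]_w (f (X w))%:E = 0)%E.
Proof.
move=> symX mf fN intf.
have mX : measurable_fun [set: Omega] X by [].
have mNX : measurable_fun [set: Omega] (fun w => - X w).
  exact: measurableT_comp.
have /measurable_EFinP mfE := mf.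
have fNX w : (f (- X w))%:E = (- (f (X w))%:E)%E by rewrite fN EFinN.
have intfN : P.-integrable [set: Omega] ((EFin \o f) \o (fun w => - X w)).
  by rewrite (_ : _ \o _ = (\- (fun w => (f (X w))%:E))%E);
    [exact: integrableN | exact/funext].
(* Both sides are integrals of [f] against pushforward measures, by [X] and by [- X]; symmetry says
   exactly that these agree on measurable sets. *)
have EXE : (\int[P]_w (f (X w))%:E = \int[P]_w (f (- X w))%:E)%E.
  have := integral_pushforward mX mfE intf measurableT.
  rewrite preimage_setT /= => <-.
  have := integral_pushforward mNX mfE intfN measurableT.
  rewrite preimage_setT /= => <-.
  by apply: eq_measure_integral => A mA _; exact: symX.
have : (\int[P]_w (f (- X w))%:E = - \int[P]_w (f (X w))%:E)%E.
  under eq_integral do rewrite fNX.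
  by rewrite integralN// integrable_add_def.
rewrite -EXE; have := integrable_fin_num measurableT intf.
by case: (\int[P]_w (f (X w))%:E)%E => //= r _ [] ?; congr EFin; lra.
Qed.

Section ProbingRatio.
Context {R : realType} {V : finType}.
Implicit Types (W : ngram_watermark R V) (x : seq V).

(** The logarithm of the factor that the watermark puts on [t]; with it both colourings of the pair
    are handled by one computation. *)
Definition list_shift W x (t : V) : R :=
  if t \in green_list W x then strength W else 0.

(** As a difference of logarithms, oddness is a swap of the two terms, valid for every real [e],
    even where an argument of [ln] is not positive. *)
Definition log_odds (e : R) : R := ln (2^-1 + e) - ln (2^-1 - e).

Lemma log_oddsN : {morph log_odds : e / - e}.
Proof. by move=> e; rewrite /log_odds opprK opprB. Qed.

Lemma measurable_log_odds : measurable_fun [set: R] log_odds.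
Proof.
apply: measurable_funB; apply: measurableT_comp; try exact: measurable_ln.
  exact: measurable_funD.
exact: measurable_funB.
Qed.

(** Red tokens carry the factor [expR 0 = 1], so the red and green sums merge into a single sum over
    [V]. *)
Lemma watermarkedE W x (p : V -> R) (t : V) :
  watermarked W x p t = expR (list_shift W x t) * p t /
    \sum_t' expR (list_shift W x t') * p t'.
Proof.
rewrite /watermarked /list_shift; congr (_ / _).
  by case: ifP => _ //; rewrite expR0 mul1r.
rewrite [RHS](bigID [in red_list W x]) /=; congr (_ + _).
  apply: eq_bigr => t'; rewrite finset.in_setC => /negbTE ->.
  by rewrite expR0 mul1r.
apply: eq_big => [t'|t' ->] //.
by rewrite finset.in_setC negbK.
Qed.

Lemma relative_prob_ratioE W x (Ti Tj : V) (e : R) :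
  Ti != Tj -> - 2^-1 < e < 2^-1 ->
  relative_prob_ratio W x Ti Tj e =
    list_shift W x Ti - list_shift W x Tj + log_odds e.
Proof.
move=> TiTj /andP[e_gt e_lt].
have ei_gt0 : 0 < 2^-1 + e by lra.
have ej_gt0 : 0 < 2^-1 - e by lra.
have p_ge0 t : 0 <= probing_prob Ti Tj e t.
  by rewrite /probing_prob; do 2?[case: ifP => _] => //; exact: ltW.
rewrite /relative_prob_ratio !watermarkedE.
set Z := \sum_t' _.
(* Cancelling [Z] requires it to be nonzero: the term of [Ti] is positive, the others are
   nonnegative. *)
have Z_gt0 : 0 < Z.
  rewrite /Z (bigD1 Ti) //= ltr_pwDl //.
    by rewrite /probing_prob eqxx mulr_gt0 ?expR_gt0.
  by apply: sumr_ge0 => t _; rewrite mulr_ge0 ?expR_ge0.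
rewrite invf_div mulf_div [Z * _]mulrC -mulf_div divff ?gt_eqF// mulr1.
rewrite /probing_prob !eqxx eq_sym (negbTE TiTj).
rewrite ln_div ?posrE ?mulr_gt0 ?expR_gt0//.
rewrite !lnM ?posrE ?expR_gt0// !expRK /log_odds.
by lra.
Qed.

Lemma expectation_relative_prob_ratio W x (Ti Tj : V) (d : measure_display)
    (Omega : measurableType d) (P : probability Omega R) (eps : {RV P >-> R}) :
  Ti != Tj -> symmetrically_distributed P eps ->
  {ae P, forall w, - 2^-1 < eps w < 2^-1} ->
  P.-integrable [set: Omega]
    (fun w => (relative_prob_ratio W x Ti Tj (eps w))%:E) ->
  ('E_P[fun w => relative_prob_ratio W x Ti Tj (eps w)] =
    (list_shift W x Ti - list_shift W x Tj)%:E)%E.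
Proof.
move=> TiTj eps_sym eps_range intR.
set c := list_shift W x Ti - list_shift W x Tj.
pose r w := relative_prob_ratio W x Ti Tj (eps w).
have intc : P.-integrable [set: Omega] (EFin \o cst c).
  exact: finite_measure_integrable_cst.
have intB : P.-integrable [set: Omega] (fun w => (r w - c)%:E).
  exact: (integrableB measurableT intR intc).
have mL : measurable_fun [set: Omega] (fun w => (log_odds (eps w))%:E).
  by apply/measurable_EFinP; exact: (measurableT_comp measurable_log_odds).
have mB := measurable_int P intB.
(* The noise is in range only almost surely, so the closed form of the ratio holds only almost
   everywhere. *)
have aeB : ae_eq P [set: Omega] (fun w => (r w - c)%:E)
    (fun w => (log_odds (eps w))%:E).
  apply: filterS eps_range => w ew _.
  by rewrite /r (relative_prob_ratioE _ _ _ _ _ TiTj ew) -/c addrC addKr.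
(* Integrability passes from the ratio to the log-odds: the absolute values of [r - c] and of the
   log-odds have the same integral. *)
have intL : P.-integrable [set: Omega] (fun w => (log_odds (eps w))%:E).
  apply/integrableP; split=> //.
  have /integrableP[_] := intB; congr (_ < _)%E.
  apply: ae_eq_integral => //; [exact: measurableT_comp.. |].
  by apply: filterS aeB => w h /h /= [->].
have intB0 : (\int[P]_w (r w - c)%:E = 0)%E.
  rewrite (ae_eq_integral _ _ measurableT mB mL aeB).
  exact: integral_odd_symmetric eps_sym measurable_log_odds log_oddsN intL.
rewrite unlock -/r.
(* Adding [c] back contributes exactly [c], since [P] has total mass 1. *)
transitivity (\int[P]_w ((r w - c)%:E + (cst c w)%:E))%E.
  by apply: eq_integral => w _; rewrite -EFinD subrK.
rewrite (integralD measurableT intB intc) intB0 add0e.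
by have := expectation_cst P c; rewrite unlock.
Qed.

End ProbingRatio.

Theorem theorem4p1 (R : realType) (V : finType) (W : ngram_watermark R V)
    (x : seq V) (Ti Tj : V)
    (d : measure_display) (Omega : measurableType d) (P : probability Omega R)
    (eps : {RV P >-> R})
    (eps_sym : symmetrically_distributed P eps)
    (eps_range : {ae P, forall w, - 2^-1 < eps w < 2^-1})
    (ratio_integrable : P.-integrable [set: Omega]
       (fun w => (relative_prob_ratio W x Ti Tj (eps w))%:E)) :
  (Ti \in green_list W x -> Tj \in red_list W x ->
     ('E_P[fun w => relative_prob_ratio W x Ti Tj (eps w)] = (strength W)%:E)%E) /\
  (Ti \in red_list W x -> Tj \in green_list W x ->
     ('E_P[fun w => relative_prob_ratio W x Ti Tj (eps w)] = (- strength W)%R%:E)%E).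
Proof.
split=> [Tig | ]; rewrite finset.in_setC.
  move=> Tjr; rewrite expectation_relative_prob_ratio//.
    by rewrite /list_shift Tig (negbTE Tjr) subr0.
  (* Opposite colours force the two tokens to be distinct. *)
  by apply: contraNneq Tjr => <-.
move=> Tir Tjg; rewrite expectation_relative_prob_ratio//.
  by rewrite /list_shift Tjg (negbTE Tir) sub0r.
by apply: contraNneq Tir => ->.
Qed.
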